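(* Let $r\ge 2$ and let $n_r\ge n_{r-1}\ge\cdots\ge n_1$ be positive integers. (i) If $n_1\ge 3$, then $ar_r(\mathcal{K}_{n_1,\ldots,n_r},M_2)=1$. (ii) If $n_1=2$, let $t$ be the largest integer such that $n_t=n_1=2$. Then $ar_r(\mathcal{K}_{n_1,\ldots,n_r},M_2)=2^{t-1}$.
   Context: For disjoint vertex sets $V_1,\ldots,V_r$ with $|V_i|=n_i$, the complete $r$-partite $r$-uniform hypergraph $\mathcal{K}_{n_1,\ldots,n_r}$ has vertex set $V_1\cup\cdots\cup V_r$ and edge set all $r$-element sets $S$ with $|S\cap V_i|=1$ for every $i$. $M_2$ denotes a 2-matching (two disjoint edges). An edge-colored hypergraph is rainbow if all its edges have distinct colors. $ar_r(\mathcal{G},\mathcal{H})$ denotes the maximum number of colors in an edge-coloring of $\mathcal{G}$ containing no rainbow copy of $\mathcal{H}$. *)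

(* Defs.v *)
From mathcomp Require Import all_boot.

Set Implicit Arguments.
Unset Strict Implicit.
Unset Printing Implicit Defensive.

Record hypergraph := Hypergraph {
  vertex : finType;
  edges : {set {set vertex}}
}.

(* The vertex (i, x) is the x-th vertex of the i-th part. *)
Definition complete_partite_vertex (r : nat) (n : 'I_r -> nat) : finType :=
  {i : 'I_r & 'I_(n i)}.

Definition part (r : nat) (n : 'I_r -> nat) (i : 'I_r) :
    {set complete_partite_vertex n} :=
  [set v | tag v == i].

Definition complete_partite (r : nat) (n : 'I_r -> nat) : hypergraph :=
  @Hypergraph (complete_partite_vertex n)
    [set S : {set complete_partite_vertex n} |
       (#|S| == r) && [forall i, #|S :&: part n i| == 1]].

(* The r-uniform k-matching: the edges are the k rows of 'I_k * 'I_r. *)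
Definition matching (r k : nat) : hypergraph :=
  @Hypergraph ('I_k * 'I_r)%type
    [set [set v : 'I_k * 'I_r | v.1 == i] | i : 'I_k].

Definition is_copy (G H : hypergraph) (F : {set {set vertex G}}) : Prop :=
  exists f : vertex H -> vertex G,
    [/\ injective f,
        F = [set f @: (e : {set vertex H}) | e in edges H] &
        F \subset edges G].

(* A coloring is a total function on vertex sets; every notion below only
   looks at its values on edges of G. *)
Definition coloring (G : hypergraph) := {set vertex G} -> nat.

Definition num_colors (G : hypergraph) (c : coloring G) : nat :=
  size (undup [seq c e | e in edges G]).

Definition rainbow (G : hypergraph) (c : coloring G)
    (F : {set {set vertex G}}) : Prop :=
  {in F &, injective c}.

Definition rainbow_free (G H : hypergraph) (c : coloring G) : Prop :=
  forall F : {set {set vertex G}}, is_copy H F -> ~ rainbow c F.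

(* ar(G, H) = k *)
Definition is_ar (G H : hypergraph) (k : nat) : Prop :=
  (exists c : coloring G, rainbow_free H c /\ num_colors c = k) /\
  (forall c : coloring G, rainbow_free H c -> num_colors c <= k).

(* Main.v *)
Require Import Defs.
From mathcomp Require Import all_boot.

Set Implicit Arguments.
Unset Strict Implicit.
Unset Printing Implicit Defensive.

(** Edges of the complete [r]-partite hypergraph are choice functions [f], and
    a coloring has no rainbow 2-matching iff it is constant on every pair of
    choice functions that differ in all coordinates.  Hence the answer is the
    number of connected components of the graph formed by these pairs.
    Let [T] be the set of parts of size 2.  Two choice functions that agree on
    [T] have a common neighbour: flip every coordinate in [T], and use a third
    vertex in every other part.  As each step of the graph flips all
    coordinates in [T], the components are the classes of 0/1-vectors indexed
    by [T], up to complementation; there are [2 ^ (#|T| - 1)] of them, and just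
    one if [T] is empty. *)

(** * Counting colors through an edge invariant *)

Section ColorCount.

Variables (G : hypergraph) (U : finType) (c : coloring G).
Variable s : {set vertex G} -> U.

(** The color factors through [s], so one representative edge per value of [s] already lists every
    color. *)
Lemma num_colors_le_imset :
  {in edges G &, forall e1 e2, s e1 = s e2 -> c e1 = c e2} ->
  num_colors c <= #|s @: edges G|.
Proof.
move=> sc; rewrite /num_colors cardE.
(* The default [0] is never reached on values of [s] taken at edges. *)
pose h u := if [pick e in edges G | s e == u] is Some e then c e else 0.
rewrite -(size_map h); apply: uniq_leq_size (undup_uniq _) _ => k.
rewrite mem_undup => /imageP[e eG ->]; apply/mapP; exists (s e).
  by rewrite mem_enum imset_f.
rewrite /h; case: pickP => [e' /andP[e'G /eqP se']|/(_ e)].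
  exact: sc.
by rewrite eG eqxx.
Qed.

Lemma num_colors_enum_rank :
  num_colors (fun e : {set vertex G} => enum_rank (s e) : nat)
    = #|s @: edges G|.
Proof.
rewrite /num_colors [#|s @: _|]cardE -(size_map (fun u => enum_rank u : nat)).
apply/perm_size/uniq_perm; first exact: undup_uniq.
  by rewrite map_inj_uniq ?enum_uniq // => u v /val_inj/enum_rank_inj.
move=> k; rewrite mem_undup; apply/imageP/mapP => [[e eG ->]|[u]].
  by exists (s e); rewrite // mem_enum imset_f.
by rewrite mem_enum => /imsetP[e eG ->] ->; exists e.
Qed.

End ColorCount.

(** * Edges as choice functions, and 2-matchings as pairs that differ everywhere *)

Section ChoiceEdges.

Variables (r : nat) (n : 'I_r -> nat).
Implicit Types (f g : forall i, 'I_(n i)) (c : coloring (complete_partite n)).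

Definition choice_edge f : {set complete_partite_vertex n} :=
  [set v | tagged v == f (tag v)].

Lemma mem_choice_edge f i (x : 'I_(n i)) :
  (Tagged (fun i => 'I_(n i)) x \in choice_edge f) = (x == f i).
Proof. by rewrite inE. Qed.

Lemma choice_edge_imset f :
  choice_edge f = [set Tagged (fun i => 'I_(n i)) (f i) | i : 'I_r].
Proof.
apply/setP=> -[i x]; rewrite mem_choice_edge; apply/eqP/imsetP => [->|[j _]].
  by exists i.
by move=> E; have Ei := congr1 tag E; rewrite /= in Ei; subst j;
  apply/eqP; move/eqP: E; rewrite eq_Tagged.
Qed.

Lemma choice_edge_in f : choice_edge f \in edges (complete_partite n).
Proof.
rewrite inE; apply/andP; split.
  rewrite choice_edge_imset card_imset ?card_ord // => i j E.
  exact: (congr1 tag E).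
apply/forallP=> i; apply/cards1P; exists (Tagged (fun i => 'I_(n i)) (f i)).
apply/setP=> -[j x]; rewrite !inE /=.
apply/andP/eqP => [[/eqP-> /eqP ji]|E].
  by subst j.
have Ei := congr1 tag E; rewrite /= in Ei; subst j; split=> //.
by move/eqP: E; rewrite eq_Tagged.
Qed.

Lemma edge_choiceP (e : {set vertex (complete_partite n)}) :
  e \in edges (complete_partite n) -> exists f, e = choice_edge f.
Proof.
rewrite inE => /andP[_ /forallP e1].
have ex i : exists x : 'I_(n i), Tagged (fun i => 'I_(n i)) x \in e.
  have /cards1P[[j x] E] := e1 i.
  have : existT _ j x \in e :&: part n i by rewrite E set11.
  by rewrite !inE /= => /andP[xe /eqP ji]; subst j; exists x.
exists (fun i => xchoose (ex i)); apply/setP=> -[i x]; rewrite mem_choice_edge.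
have /cards1P[v E] := e1 i.
have inv (y : 'I_(n i)) :
    Tagged (fun i => 'I_(n i)) y \in e -> Tagged (fun i => 'I_(n i)) y = v.
  by move=> ye; apply/set1P; rewrite -E !inE ye /=.
apply/idP/eqP => [xe|->]; last exact: (xchooseP (ex i)).
have := inv _ (xchooseP (ex i)); rewrite -(inv x xe) => /eqP.
by rewrite eq_Tagged => /eqP.
Qed.

Lemma matching2_edgesP (e : {set vertex (matching r 2)}) :
  reflect (exists k : 'I_2, e = [set v : 'I_2 * 'I_r | v.1 == k])
          (e \in edges (matching r 2)).
Proof. by apply: (iffP imsetP) => [[k _ ->]|[k ->]]; exists k. Qed.

(** Choice functions that differ everywhere have disjoint edges, hence span a 2-matching. With only
    two edges, distinct colors would make it rainbow. *)
Lemma rainbow_free_eq c f g :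
  rainbow_free (matching r 2) c -> (forall i, f i != g i) ->
  c (choice_edge f) = c (choice_edge g).
Proof.
move=> rf fg; pose h (k : 'I_2) i := if k == ord0 then f i else g i.
pose m (v : vertex (matching r 2)) : vertex (complete_partite n) :=
  Tagged (fun i => 'I_(n i)) (h v.1 v.2).
have row k : m @: [set v : 'I_2 * 'I_r | v.1 == k] = choice_edge (h k).
  rewrite choice_edge_imset; apply/setP=> u; apply/imsetP/imsetP.
    by case=> -[k' i]; rewrite inE => /eqP/= -> ->; exists i.
  by case=> i _ ->; exists (k, i); rewrite ?inE.
have cpy : is_copy (matching r 2)
    [set m @: (e : {set vertex (matching r 2)}) | e in edges (matching r 2)].
  exists m; split=> //.
    case=> k i [k' j] E; have ij := congr1 tag E; rewrite /= in ij; subst j.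
    congr pair; move/eqP: E; rewrite eq_Tagged /= /h => /eqP.
    case: k k' => [[|[|//]] ?] [[|[|//]] ?] //= E; try exact: val_inj.
      by have := fg i; rewrite E eqxx.
    by have := fg i; rewrite E eqxx.
  apply/subsetP=> e /imsetP[_ /matching2_edgesP[k ->] ->].
  by rewrite row choice_edge_in.
apply/eqP/negPn/negP => cfg; apply: (rf _ cpy) => e1 e2.
move=> /imsetP[_ /matching2_edgesP[k ->] ->].
move=> /imsetP[_ /matching2_edgesP[k' ->] ->]; rewrite !row /h.
case: k k' => [[|[|//]] ?] [[|[|//]] ?] //= E.
  by case/eqP: cfg.
by case/eqP: cfg.
Qed.

Lemma rainbow_freeP c : 0 < r ->
  (forall f g, (forall i, f i != g i) ->
     c (choice_edge f) = c (choice_edge g)) ->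
  rainbow_free (matching r 2) c.
Proof.
move=> r_gt0 cE F [m [m_inj -> FG]] rb.
pose row (k : 'I_2) := m @: [set v : 'I_2 * 'I_r | v.1 == k].
have rowF k : row k \in [set m @: (e : {set vertex (matching r 2)})
                           | e in edges (matching r 2)].
  by apply: imset_f; apply/matching2_edgesP; exists k.
have /edge_choiceP[f Ef] := subsetP FG _ (rowF ord0).
have /edge_choiceP[g Eg] := subsetP FG _ (rowF ord_max).
have row_disj v : v \in row ord0 -> v \notin row ord_max.
  case/imsetP=> u; rewrite inE => /eqP u0 ->; apply/imsetP=> -[u'].
  by rewrite inE => /eqP u1 /m_inj uu'; move: u1; rewrite -uu' u0.
have fg i : f i != g i.
  have := @row_disj (Tagged (fun i => 'I_(n i)) (f i)).
  by rewrite Ef Eg !mem_choice_edge eqxx => /(_ isT).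
have E : row ord0 = row ord_max by apply: rb => //; rewrite Ef Eg; exact: cE.
(* The two disjoint rows have become equal; [r_gt0] supplies a vertex in them, hence the
   contradiction. *)
have /row_disj : m (ord0, Ordinal r_gt0) \in row ord0 by rewrite imset_f ?inE.
by rewrite -E imset_f ?inE.
Qed.

End ChoiceEdges.

(** * Choosing and flipping values within one part *)

Lemma ord2_eq (m : nat) (x y : 'I_m) :
  m = 2 -> (x == 0 :> nat) = (y == 0 :> nat) -> x = y.
Proof.
by move=> m2; subst m; case: x y => [[|[|//]] ?] [[|[|//]] ?] //= _;
  apply: val_inj.
Qed.

Lemma ord2_neq (m : nat) (x y : 'I_m) :
  m = 2 -> x != y -> (x == 0 :> nat) = ~~ (y == 0 :> nat).
Proof. by move=> m2; subst m; case: x y => [[|[|//]] ?] [[|[|//]] ?]. Qed.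

Lemma ord_avoid2 (m : nat) (x y : 'I_m) :
  1 < m -> (m = 2 -> x = y) -> exists z : 'I_m, (z != x) && (z != y).
Proof.
move=> m_gt1 m2; have : 0 < #|~: [set x; y]|.
  rewrite cardsCs setCK card_ord subn_gt0 cards2.
  case: eqVneq => //= xy; rewrite ltn_neqAle m_gt1 andbT.
  by apply/eqP => m2'; case/eqP: xy; apply: m2.
by case/card_gt0P=> z; rewrite !inE negb_or => ?; exists z.
Qed.

(** * The components and their number *)

Section AntiRamsey.

Variables (r : nat) (n : 'I_r -> nat) (i0 : 'I_r).
Hypothesis n_gt1 : forall i, 1 < n i.
Hypothesis i0_pair : forall i, n i = 2 -> n i0 = 2.
Implicit Types (f g : forall i, 'I_(n i)) (c : coloring (complete_partite n)).

Let pairs := [set i | n i == 2].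

Let bit (e : {set complete_partite_vertex n}) (i : 'I_r) : bool :=
  [exists v in e, (tag v == i) && (tagged v == 0 :> nat)].

(* Comparing with the part [i0] identifies a 0/1-vector with its complement. *)
Let sig (e : {set complete_partite_vertex n}) : {set 'I_r} :=
  [set i in pairs | bit e i != bit e i0].

Let bitE f i : bit (choice_edge f) i = (f i == 0 :> nat).
Proof.
apply/exists_inP/idP => [[v]|fi0].
  rewrite inE => /eqP-> /andP[/eqP vi]; move: vi; case: v => j x /= ji.
  by subst j.
by exists (Tagged (fun i => 'I_(n i)) (f i)); rewrite ?mem_choice_edge ?eqxx.
Qed.

Let sigE f i : (i \in sig (choice_edge f)) =
  (n i == 2) && ((f i == 0 :> nat) != (f i0 == 0 :> nat)).
Proof. by rewrite !inE !bitE. Qed.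

(** Bits [i] and [i0] are flipped together, so whether they differ is preserved. *)
Let sig_disjoint f g :
  (forall i, f i != g i) -> sig (choice_edge f) = sig (choice_edge g).
Proof.
move=> fg; apply/setP=> i; rewrite !sigE; case: eqP => //= ni.
rewrite (ord2_neq ni (fg i)) (ord2_neq (i0_pair ni) (fg i0)).
by rewrite (inj_eq negb_inj).
Qed.

Let eq_color_on_pairs c f g :
  rainbow_free (matching r 2) c -> (forall i, n i = 2 -> f i = g i) ->
  c (choice_edge f) = c (choice_edge g).
Proof.
move=> rf fg; have ex i := ord_avoid2 (n_gt1 i) (fg i).
pose z i := xchoose (ex i).
rewrite -(rainbow_free_eq (f := z) rf); last first.
  by move=> i; have /andP[] := xchooseP (ex i).
by apply: rainbow_free_eq rf _ => i; have /andP[] := xchooseP (ex i).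
Qed.

Let sig_color c f g :
  rainbow_free (matching r 2) c -> sig (choice_edge f) = sig (choice_edge g) ->
  c (choice_edge f) = c (choice_edge g).
Proof.
move=> rf /setP sfg.
(* Equal signatures force [f] and [g] to agree on all of [pairs] or to be complementary there;
   coordinate [i0] decides which. *)
have bits i : n i = 2 ->
    ((f i == 0 :> nat) == (g i == 0 :> nat))
      = ((f i0 == 0 :> nat) == (g i0 == 0 :> nat)).
  move=> /eqP ni; have := sfg i; rewrite !sigE ni /=.
  by do 4!case: (_ == 0 :> nat).
case: (boolP ((f i0 == 0 :> nat) == (g i0 == 0 :> nat))) => fg0.
  apply: eq_color_on_pairs rf _ => i ni; apply: (ord2_eq ni).
  by move: (bits i ni); rewrite fg0 => /eqP.
(* Complementary case: a neighbour [z] of [f] can be chosen equal to [g] on [pairs], which reduces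
   to the case of agreement. *)
have ex i : exists z : 'I_(n i), (z != f i) && ((n i == 2) ==> (z == g i)).
  case: eqP => ni /=.
    exists (g i); rewrite eqxx andbT; apply: contra fg0 => /eqP gf.
    by rewrite -(bits i ni) gf.
  have [//|z /andP[zf _]] := @ord_avoid2 _ (f i) (f i) (n_gt1 i).
  by exists z; rewrite zf.
pose z i := xchoose (ex i).
rewrite -(rainbow_free_eq (f := z) rf); last first.
  by move=> i; have /andP[] := xchooseP (ex i).
apply: eq_color_on_pairs rf _ => i /eqP ni; apply/eqP.
by have /andP[_ /implyP] := xchooseP (ex i); exact.
Qed.

Let sig_edges :
  sig @: edges (complete_partite n) = powerset (pairs :\ i0).
Proof.
apply/setP=> S; rewrite powersetE; apply/imsetP/subsetP => [[e _ -> i]|sS].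
  rewrite !inE => /andP[-> bb]; rewrite andbT.
  by apply: contraNneq bb => ->.
have n_gt0 i := ltnW (n_gt1 i).
(* Value 1 on [S] and 0 elsewhere: as [i0] lies outside [S], the bits differing from that of [i0]
   are exactly those in [S]. *)
pose f i := if i \in S then Ordinal (n_gt1 i) else Ordinal (n_gt0 i).
exists (choice_edge f); first exact: choice_edge_in.
have S0 : i0 \notin S by apply/negP => /sS; rewrite !inE eqxx.
apply/setP=> i; rewrite sigE {2}/f (negPf S0) /f.
case: ifP => iS /=; last by rewrite andbF.
by have := sS i iS; rewrite !inE => /andP[_ ->].
Qed.

Let card_sig_edges :
  #|sig @: edges (complete_partite n)| = 2 ^ #|pairs|.-1.
Proof.
rewrite sig_edges card_powerset; congr (2 ^ _).
(* If [i0] is not in [pairs], then [pairs] is empty and the truncated exponent [0.-1 = 0] gives the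
   single color. *)
have [i0P|] := boolP (i0 \in pairs); first by rewrite [in RHS](cardsD1 i0) i0P.
rewrite inE => /eqP i0N; suff -> : pairs = set0 by rewrite set0D cards0.
by apply/setP=> i; rewrite !inE; apply/negP => /eqP/i0_pair.
Qed.

Theorem is_ar_complete_partite_matching2 :
  is_ar (complete_partite n) (matching r 2) (2 ^ #|pairs|.-1).
Proof.
rewrite -card_sig_edges; split.
  exists (fun e : {set complete_partite_vertex n} => enum_rank (sig e) : nat).
  split; last exact: num_colors_enum_rank.
  apply: rainbow_freeP => [|f g fg]; first exact: leq_ltn_trans (ltn_ord i0).
  by rewrite (sig_disjoint fg).
move=> c rf; apply: num_colors_le_imset => e1 e2.
move=> /edge_choiceP[f ->] /edge_choiceP[g ->]; exact: sig_color.
Qed.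

End AntiRamsey.

(** * Specialization to sorted part sizes *)

Theorem theorem1p7 (r : nat) (n : nat -> nat)
  (hr : 2 <= r)
  (hpos : forall i : nat, 1 <= i <= r -> 0 < n i)
  (hmono : forall i j : nat, 1 <= i -> i <= j -> j <= r -> n i <= n j) :
  (3 <= n 1 ->
     is_ar (complete_partite (fun i : 'I_r => n i.+1)) (matching r 2) 1) /\
  (n 1 = 2 ->
     forall t : nat,
       1 <= t <= r -> n t = n 1 ->
       (forall s : nat, 1 <= s <= r -> n s = n 1 -> s <= t) ->
       is_ar (complete_partite (fun i : 'I_r => n i.+1)) (matching r 2)
         (2 ^ (t - 1))).
Proof.
pose i0 : 'I_r := Ordinal (ltnW hr).
have n1_le (i : 'I_r) : n 1 <= n i.+1 by exact: hmono.
split=> [n1_gt2|n1 t /andP[t_gt0 t_le] nt t_max].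
  have n_gt2 (i : 'I_r) : 2 < n i.+1 := leq_trans n1_gt2 (n1_le i).
  have := @is_ar_complete_partite_matching2 r (fun i => n i.+1) i0.
  rewrite (_ : [set i : 'I_r | n i.+1 == 2] = set0) ?cards0; last first.
    by apply/setP=> i; rewrite !inE gtn_eqF.
  by apply=> i; [exact: ltnW | move=> ni; have := n_gt2 i; rewrite ni].
have card_pairs : #|[set i : 'I_r | n i.+1 == 2]| = t.
  (* By monotonicity the parts of size 2 are the first [t], that is, the 0-based indices below
     [t]. *)
  rewrite (_ : [set i : 'I_r | n i.+1 == 2] = widen_ord t_le @: setT).
    rewrite card_imset ?cardsT ?card_ord // => i j /(congr1 val) /= ij.
    exact: val_inj.
  apply/setP=> i; rewrite inE; apply/eqP/imsetP => [ni|[j _ ->] /=].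
    have it : i < t by apply: t_max; rewrite ?n1 //=.
    by exists (Ordinal it) => //; apply: val_inj.
  apply/eqP; rewrite eqn_leq -{1}n1 -nt hmono //=.
  by rewrite -n1 (n1_le (widen_ord t_le j)).
have := @is_ar_complete_partite_matching2 r (fun i => n i.+1) i0.
by rewrite card_pairs -subn1; apply=> // i; rewrite -n1.
Qed.
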